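(* Let $p$ be a prime, let $0<\mathbf k<\omega$, and let $J=J^{\mathrm{bd}}_{\aleph_1}$ be the ideal of bounded subsets of $\omega_1$. Then $(\aleph_1,J)$ fits the triple $(\aleph_1,\mathbf d^1_p,\Xi^1_p)$; that is, with $\partial_m=\omega_1$ and $J_m=J$ for all $m<\mathbf k$, the pair $(\langle\partial_m:m<\mathbf k\rangle,\langle J_m:m<\mathbf k\rangle)$ fits $(\aleph_1,\mathbf d^1_p,\Xi^1_p)$.
   Context: All groups are abelian and all rings are commutative. **Module parameters.** A module parameter is a tuple $\mathbf d=\langle R,M^*,\mathcal M,\theta\rangle=\langle R_{\mathbf d},M^*_{\mathbf d},\mathcal M_{\mathbf d},\theta_{\mathbf d}\rangle$ with $R$ a ring, $M^*$ an $R$-module, $\mathcal M$ a set or class of $R$-modules, $\theta\ge\aleph_0$ a regular cardinal. An $R$-module is semi-$\mathbf d$-free (in $\mathbf K^{\rm sfr}_{\mathbf d}$) if it is a direct sum of modules each isomorphic to a member of $\mathcal M$; it is $\mathbf d$-free (in $\mathbf K^{\rm fr}_{\mathbf d}$) if it is the direct sum of a semi-$\mathbf d$-free module and a module isomorphic to $M^*$. **Module problems.** A $\mathbf d$-problem is a set (or class) $\Xi$ of triples $(G,H,h)$ with $G,H$ $R_{\mathbf d}$-modules and $h$ a nonzero $R_{\mathbf d}$-homomorphism from $G$ to $H$. $(\chi,\mathbf d,\Xi)$ is a module problem if $\chi$ is an infinite cardinal, $\mathbf d$ is a module parameter, $\Xi$ is a $\mathbf d$-problem with $|\Xi|\le\chi$,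 $|H_*|+|G_*|\le\chi$ for every $(G_*,H_*,h_* )\in\Xi$, $\mathcal M_{\mathbf d}$ and each of its members have cardinality $\le\chi$, and $|M^*_{\mathbf d}|\le\chi$. **Fitting.** Let $\bar\partial=\langle\partial_m:m<\mathbf k\rangle$ be a sequence of limit ordinals and $\bar J=\langle J_m:m<\mathbf k\rangle$ with $J_m$ an ideal on $\partial_m$. $(\bar\partial,\bar J)$ $\theta$-fits $(\chi,\mathbf d,\Xi)$ if $(\chi,\mathbf d,\Xi)$ is a module problem and, with $R=R_{\mathbf d}$, $M^*=M^*_{\mathbf d}$: whenever $(G_*,H_*,h_* )\in\Xi$; $M_*\in\mathbf K^{\rm fr}_{\mathbf d}$ with $M_*=M^*\oplus N$ for some $N\in\mathbf K^{\rm sfr}_{\mathbf d}$; $h_0\in\mathrm{Hom}_R(G_*,M_* )$; $M_{m,i}\in\mathbf K^{\rm sfr}_{\mathbf d}$ for $m<\mathbf k$, $i<\partial_m$ with $\sum_{m,i}|M_{m,i}|<\theta$; $G_0=\bigoplus\{M_{m,i}:m<\mathbf k,i<\partial_m\}\oplus M_*$; and $h_1\in\mathrm{Hom}_R(G_0,H_* )$ with $h_1(h_0(x))=h_*(x)$ for all $x\in G_*$; then there is $G_1$ such that $(\alpha)$ $G_1$ is an $R$-module extending $G_0$, $(\beta)$ $|G_1|<\theta$, $(\gamma)$ no $R$-homomorphism from $G_1$ to $H_*$ extends $h_1$. ''Fits'', without mention of $\theta$, means $\theta$-fits for $\theta=|R|^++\max\{|\partial_m|^+:m<\mathbf k\}$.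 **The specific data.** $\mathbf d^1_p=\langle R,M^*,\mathcal M,\theta\rangle$ with $R=\mathbb Z$, $M^*=0$, $\mathcal M=\{\mathbb Z/p^n\mathbb Z:n=1,2,\dots\}$, $\theta=\aleph_1$. $\Xi^1_p$ is the class of triples $(G_*,H_*,h_* )$ where $G_*=\bigoplus\{G^*_{m,\alpha}:m<\mathbf k,\ \alpha<\omega_1\}$ with $G^*_{m,\omega\alpha+n}\cong\mathbb Z/p^{n+1}\mathbb Z$ for all $m<\mathbf k$, $\alpha<\omega_1$, $n<\omega$ (every ordinal below $\omega_1$ being uniquely of the form $\omega\alpha+n$), $H_*=G_*$ and $h_*=\mathrm{id}_{G_*}$.
   Formalization: Clause (β) |G_1|<θ is required only when |M_*|<θ (it is impossible otherwise, since G_1 contains M_*; e.g. M_*=G_*⊕(Z/p)^(ℵ_2)), and |Ξ|≤χ counts isomorphism types of triples, as Ξ is a proper class. *)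

(* Defs.v *)
From HB Require Import structures.
From mathcomp Require Import all_boot all_order all_algebra.
From mathcomp Require Import boolp classical_sets functions cardinality wochoice.

Set Implicit Arguments.
Unset Strict Implicit.
Unset Printing Implicit Defensive.

Import Order.TTheory GRing.Theory Num.Theory.
Local Open Scope classical_set_scope.
Local Open Scope card_scope.
Local Open Scope ring_scope.

(** * Cardinals

  A cardinal is represented by a type of that cardinality, and cardinal sums
  by [sum] and sigma types. *)

Definition card_leT (A B : Type) : Prop := [set: A] #<= [set: B].
Definition card_ltT (A B : Type) : Prop := card_leT A B /\ ~ card_leT B A.

Definition regular_cardinal (T : Type) : Prop :=
  infinite_set [set: T] /\
  forall (D : set T) (F : T -> set T),
    ~ ([set: T] #<= D) -> (forall i, D i -> ~ ([set: T] #<= F i)) ->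
    \bigcup_(i in D) F i <> [set: T].

(** The successor cardinal of [K], as an initial ordinal: fix a well-order of
  [set K], and keep the points with at most [K] strict predecessors.  This
  initial segment does not embed in [K]: if it is all of [set K], by Cantor's
  theorem; otherwise because it is the set of strict predecessors of the least
  point left out.  Its proper initial segments do. *)

Definition set_wo (K : Type) : rel (set K) :=
  sval (well_ordering_principle (set K)).

Definition succ_card (K : Type) : Type :=
  {x : set K |
    `[< [set y | set_wo y x /\ y <> x] #<= [set: K] >]}.

HB.instance Definition _ K := gen_eqMixin (succ_card K).
HB.instance Definition _ K := gen_choiceMixin (succ_card K).

Definition succ_card_le (K : Type) : rel (succ_card K) :=
  fun x y => set_wo (sval x) (sval y).

Lemma set_wo_chain K : wo_chain (@set_wo K) predT.
Proof. by move=> A _; apply: (svalP (well_ordering_principle (set K))). Qed.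

Lemma succ_card_le_anti K : antisymmetric (@succ_card_le K).
Proof.
move=> x y h; apply: val_inj.
exact: (wo_chain_antisymmetric (@set_wo_chain K)).
Qed.

Lemma succ_card_le_total K : total (@succ_card_le K).
Proof. by move=> x y; apply: (wo_chainW (@set_wo_chain K)). Qed.

Lemma set_wo_trans K : transitive (@set_wo K).
Proof.
move=> y x z xy yz.
have [||m [[m_in m_min] _]] := @set_wo_chain K (pred3 x y z).
- by [].
- by exists x; rewrite inE eqxx.
have mx : set_wo m x by apply: m_min; rewrite inE eqxx.
have my : set_wo m y by apply: m_min; rewrite inE eqxx orbT.
have mz : set_wo m z by apply: m_min; rewrite inE eqxx !orbT.
have anti := wo_chain_antisymmetric (@set_wo_chain K).
move: m_in; rewrite inE => /or3P[] /eqP em; rewrite em in mx my mz => //.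
- by rewrite (anti x y) // xy mx.
- by rewrite -(anti y z) // yz my.
Qed.

Lemma succ_card_le_trans K : transitive (@succ_card_le K).
Proof. by move=> y x z; apply: set_wo_trans. Qed.

Lemma succ_card_le_refl K : reflexive (@succ_card_le K).
Proof. by move=> x; have := succ_card_le_total x x; rewrite orbb. Qed.

Fact succ_card_display : Order.disp_t. Proof. exact: Order.Disp tt tt. Qed.

HB.instance Definition _ K := Order.Le_isPOrder.Build succ_card_display
  (succ_card K) (@succ_card_le_refl K) (@succ_card_le_anti K)
  (@succ_card_le_trans K).
HB.instance Definition _ K := Order.POrder_isTotal.Build succ_card_display
  (succ_card K) (@succ_card_le_total K).

Definition omega1 : orderType succ_card_display := succ_card nat.

(** * Ordinals and ideals

  An ordinal is represented by a well-ordered type. *)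

Definition limit_ordinal d (T : orderType d) : Prop :=
  [/\ forall A : set T, A !=set0 ->
        exists2 x, A x & forall y, A y -> (x <= y)%O,
      [set: T] !=set0
    & forall x : T, exists y, (x < y)%O].

Definition is_ideal (T : Type) (J : set (set T)) : Prop :=
  [/\ J set0,
      forall A B, A `<=` B -> J B -> J A,
      forall A B, J A -> J B -> J (A `|` B)
    & ~ J [set: T]].

Definition bounded_ideal d (T : orderType d) : set (set T) :=
  [set A | has_ubound A].
Arguments bounded_ideal {d} T _.

(** * Direct sums of modules *)

Section DirectSum.
Variables (R : pzRingType) (I : Type) (M : I -> lmodType R).

Definition dsum : Type :=
  {f : forall i, M i | `[< finite_set [set i | f i != 0] >]}.

HB.instance Definition _ := gen_eqMixin dsum.
HB.instance Definition _ := gen_choiceMixin dsum.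

Implicit Types (f g h : dsum) (a b : R).

Lemma dsum_ext f g : (forall i, sval f i = sval g i) -> f = g.
Proof. by move=> fg; apply: val_inj; apply: functional_extensionality_dep. Qed.

Lemma dsum_finite f : finite_set [set i | sval f i != 0].
Proof. by apply/asboolP; apply: (svalP f). Qed.

Definition dsum0 : dsum.
Proof.
exists (fun i => 0); apply/asboolP.
by rewrite (_ : [set i | _] = set0) // -subset0 => i /=; rewrite eqxx.
Defined.

Definition dsum_opp f : dsum.
Proof.
exists (fun i => - sval f i); apply/asboolP.
by apply: sub_finite_set (dsum_finite f) => i /=; rewrite oppr_eq0.
Defined.

Definition dsum_add f g : dsum.
Proof.
exists (fun i => sval f i + sval g i); apply/asboolP.
have fgP : finite_set ([set i | sval f i != 0] `|` [set i | sval g i != 0]).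
  by rewrite finite_setU; split; apply: dsum_finite.
apply: sub_finite_set fgP => i /= ne0.
have [fi0|] := eqVneq (sval f i) 0; last by left.
by right; move: ne0; rewrite fi0 add0r.
Defined.

Definition dsum_scale a f : dsum.
Proof.
exists (fun i => a *: sval f i); apply/asboolP.
apply: sub_finite_set (dsum_finite f) => i /=.
by apply: contra_neq => ->; rewrite scaler0.
Defined.

Lemma dsum_addA : associative dsum_add.
Proof. by move=> f g h; apply: dsum_ext => i; apply: addrA. Qed.

Lemma dsum_addC : commutative dsum_add.
Proof. by move=> f g; apply: dsum_ext => i; apply: addrC. Qed.

Lemma dsum_add0 : left_id dsum0 dsum_add.
Proof. by move=> f; apply: dsum_ext => i; apply: add0r. Qed.

Lemma dsum_addN : left_inverse dsum0 dsum_opp dsum_add.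
Proof. by move=> f; apply: dsum_ext => i; apply: addNr. Qed.

HB.instance Definition _ := GRing.isZmodule.Build dsum
  dsum_addA dsum_addC dsum_add0 dsum_addN.

Lemma dsum_scaleA a b f :
  dsum_scale a (dsum_scale b f) = dsum_scale (a * b) f.
Proof. by apply: dsum_ext => i; apply: scalerA. Qed.

Lemma dsum_scale1 : left_id 1 dsum_scale.
Proof. by move=> f; apply: dsum_ext => i; apply: scale1r. Qed.

Lemma dsum_scaleDr : right_distributive dsum_scale +%R.
Proof. by move=> a f g; apply: dsum_ext => i; apply: scalerDr. Qed.

Lemma dsum_scaleDl f : {morph dsum_scale^~ f : a b / a + b}.
Proof. by move=> a b; apply: dsum_ext => i; apply: scalerDl. Qed.

HB.instance Definition _ := GRing.Zmodule_isLmodule.Build R dsum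
  dsum_scaleA dsum_scale1 dsum_scaleDr dsum_scaleDl.

End DirectSum.

Definition mod_iso (R : pzRingType) (M N : lmodType R) : Prop :=
  exists f : {linear M -> N}, bijective f.

(** * Module parameters and module problems *)

Record module_parameter := ModuleParameter {
  mp_ring : comPzRingType;
  mp_base : lmodType mp_ring;
  mp_class : lmodType mp_ring -> Prop;
  mp_theta : Type }.
Arguments mp_class : clear implicits.

Definition semi_free (d : module_parameter) (M : lmodType (mp_ring d)) : Prop :=
  exists (I : Type) (F : I -> lmodType (mp_ring d)),
    (forall i, exists2 N, mp_class d N & mod_iso (F i) N) /\
    mod_iso M (dsum F).

Definition d_free (d : module_parameter) (M : lmodType (mp_ring d)) : Prop :=
  exists N : lmodType (mp_ring d),
    semi_free N /\ mod_iso M (N * mp_base d)%type.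

Record hom_triple (R : pzRingType) := HomTriple {
  ht_dom : lmodType R;
  ht_cod : lmodType R;
  ht_hom : {linear ht_dom -> ht_cod} }.

Definition hom_triple_iso (R : pzRingType) (s t : hom_triple R) : Prop :=
  exists (f : {linear ht_dom s -> ht_dom t})
         (g : {linear ht_cod s -> ht_cod t}),
    [/\ bijective f, bijective g
      & forall x, ht_hom t (f x) = g (ht_hom s x)].

Definition d_problem (d : module_parameter)
    (Xi : hom_triple (mp_ring d) -> Prop) : Prop :=
  forall t, Xi t -> exists x, ht_hom t x <> 0.

(** The classes [mp_class d] and [Xi] are predicates on types too large for
  [set], whence injections in place of [#<=].  In the cases of interest [Xi] is
  closed under isomorphism, hence is proper: its cardinality is the number of
  its isomorphism types. *)
Definition module_problem (chi : Type) (d : module_parameter)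
    (Xi : hom_triple (mp_ring d) -> Prop) : Prop :=
  infinite_set [set: chi] /\
  regular_cardinal (mp_theta d) /\
  d_problem Xi /\
  (exists f : hom_triple (mp_ring d) -> chi,
     forall s t, Xi s -> Xi t -> f s = f t -> hom_triple_iso s t) /\
  (forall t, Xi t -> card_leT (ht_cod t + ht_dom t) chi) /\
  (exists f : lmodType (mp_ring d) -> chi,
     forall M N, mp_class d M -> mp_class d N -> f M = f N -> M = N) /\
  (forall M, mp_class d M -> card_leT M chi) /\
  card_leT (mp_base d) chi.

(** * Fitting *)

Section Fits.
Variables (disp : Order.disp_t) (k : nat).
Variables (del : 'I_k -> orderType disp) (J : forall m, set (set (del m))).
Variables (chi : Type) (d : module_parameter).
Variable (Xi : hom_triple (mp_ring d) -> Prop).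

(** As [G1] contains a copy of [Mstar], it can have fewer than [theta] elements
  only if [Mstar] does; this is the guard on the bound for [G1]. *)
Definition theta_fits (theta : Type) : Prop :=
  (forall m, limit_ordinal (del m)) /\
  (forall m, is_ideal (@J m)) /\
  module_problem chi Xi /\
  forall (t : hom_triple (mp_ring d)) (Mstar N : lmodType (mp_ring d))
         (h0 : {linear ht_dom t -> Mstar})
         (M : forall m, del m -> lmodType (mp_ring d)),
    Xi t ->
    d_free Mstar -> semi_free N -> mod_iso Mstar (mp_base d * N)%type ->
    (forall m i, semi_free (@M m i)) ->
    card_ltT {m : 'I_k & {i : del m & M m i}} theta ->
    let G0 := (dsum (fun mi : {m : 'I_k & del m} => M (tag mi) (tagged mi))
               * Mstar)%type in
    forall h1 : {linear G0 -> ht_cod t},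
      (forall x, h1 (0, h0 x) = ht_hom t x) ->
      exists (G1 : lmodType (mp_ring d)) (emb : {linear G0 -> G1}),
        [/\ injective emb,
            card_ltT Mstar theta -> card_ltT G1 theta
          & ~ exists g : {linear G1 -> ht_cod t}, forall x, g (emb x) = h1 x].

(** [mu] is an index at which the maximum of the successors is attained. *)
Definition fits : Prop :=
  exists mu : 'I_k,
    (forall m, card_leT (succ_card (del m)) (succ_card (del mu))) /\
    theta_fits (succ_card (mp_ring d) + succ_card (del mu))%type.

End Fits.

(** * The data attached to a prime [p] *)

(** The ring ['Z_q] is the integers modulo [q] only for [1 < q], whence the
  shifted exponent. *)
Definition Zpow (p n : nat) : lmodType int := zmodule 'Z_(p ^ n.+1).

Definition d1 (p : nat) : module_parameter :=
  @ModuleParameter int 'rV[int]_0 (fun M => exists n, M = Zpow p n)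
    omega1.

(** There is exactly one order isomorphism from the lexicographic product of
  [omega1] and [nat] to [omega1]: it sends [(a, n)] to [omega * a + n]. *)
Definition is_omega_mul_add (e : omega1 *l nat -> omega1) : Prop :=
  bijective e /\ {mono e : x y / (x <= y)%O}.

Definition Xi1 (p k : nat) (t : hom_triple (mp_ring (d1 p))) : Prop :=
  exists (F : 'I_k * omega1 -> lmodType int) (G : lmodType int)
         (e : omega1 *l nat -> omega1),
    [/\ is_omega_mul_add e,
        forall m a n, mod_iso (F (m, e (a, n))) (Zpow p n),
        mod_iso G (dsum F)
      & t = HomTriple (idfun : {linear G -> G})].
Arguments Xi1 : clear implicits.

(* Main.v *)
(** A group G as in Xi^1_p has a direct summand Z/p, and since h_* is the
  identity, h0 and h1 make G a direct summand of G0.  Embedding this copy of Z/p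
  in Z/p^2 makes its generator divisible by p in G1 = G0 (+) Z/p^2; but a
  homomorphism G1 -> G extending h1 would send it to a generator of the summand
  Z/p of G, which is not divisible by p in G.

  The cardinal bounds need aleph_1 * aleph_1 = aleph_1.  The isomorphism of
  omega * omega_1 with omega_1, given with any triple in Xi^1_p, yields
  aleph_1 * aleph_0 = aleph_1, and a pair of countable ordinals is coded by its
  maximum and a natural number. *)

From HB Require Import structures.
From mathcomp Require Import boolp functions cardinality wochoice.
Require Import Defs.
From mathcomp Require Import all_boot all_order all_algebra.
From mathcomp Require Import classical_sets.

Set Implicit Arguments.
Unset Strict Implicit.
Unset Printing Implicit Defensive.

Import Order.TTheory GRing.Theory.

(** * Comparison of cardinals by injections *)

Section Cardinals.
Local Open Scope classical_set_scope.
Local Open Scope card_scope.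

Lemma card_le_injP (T U : Type) (A : set T) (B : set U) :
  A #<= B <-> exists f : A -> B, injective f.
Proof.
split=> [/card_leP[f]|[f fI]].
  by exists f => x y; apply: inj; rewrite inE.
apply/card_leP/injfunPex; exists f => [x _|x y _ _ /fI] //.
Qed.

Lemma card_leTP (A B : Type) :
  card_leT A B <-> exists f : A -> B, injective f.
Proof.
split=> [/card_le_injP[f fI]|[f fI]].
  by exists (fun a => val (f (to_setT a))) => x y /val_inj/fI[].
apply/card_le_injP; exists (fun a => to_setT (f (val a))).
by move=> x y [] /fI /val_inj.
Qed.

Lemma card_le_set_type (T U : Type) (A : set T) :
  A #<= [set: U] <-> card_leT A U.
Proof.
by split; rewrite /card_leT (card_le_eql (card_setT A)).
Qed.

Lemma card_leT_refl (A : Type) : card_leT A A.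
Proof. exact: card_lexx. Qed.

Lemma card_leT_trans (B A C : Type) :
  card_leT A B -> card_leT B C -> card_leT A C.
Proof. exact: card_le_trans. Qed.

Lemma card_leT_prod (A A' B B' : Type) :
  card_leT A A' -> card_leT B B' -> card_leT (A * B) (A' * B').
Proof.
move=> /card_leTP[f fI] /card_leTP[g gI]; apply/card_leTP.
by exists (fun x => (f x.1, g x.2)) => -[a b] [a' b'] /= [/fI-> /gI->].
Qed.

Lemma card_leT_sum_prod (A B : Type) :
  card_leT B A -> card_leT (A + B) (A * nat).
Proof.
move=> /card_leTP[f fI]; apply/card_leTP.
exists (fun x => match x with inl a => (a, 0) | inr b => (f b, 1) end).
by move=> [a|b] [a'|b'] //= [] => [|/fI] ->.
Qed.

Lemma Cantor_card (K : Type) : ~ card_leT (set K) K.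
Proof.
move=> /card_leTP[f fI].
(* Diagonal set: the codes of the sets that miss their own code. *)
pose D : set K := [set f A | A in [set A | ~ A (f A)]].
have DN : ~ D (f D).
  by move=> DD; case: (DD) => A nA /fI eA; apply: nA; rewrite eA.
by apply: (DN); exists D.
Qed.

(** * Successor cardinals as initial ordinals *)

Section SuccCard.
Variable K : Type.
Implicit Types (x y : succ_card K) (A : set (succ_card K)).

Lemma succ_card_min A :
  A !=set0 -> exists2 x, A x & forall y, A y -> (x <= y)%O.
Proof.
move=> [x0 Ax0].
have [||z [[/asboolP[x Ax <-] zmin] _]] :=
    @set_wo_chain K [pred s | `[< exists2 x, A x & sval x = s >]].
- by [].
- by exists (sval x0); apply/asboolP; exists x0.
by exists x => // y Ay; apply: zmin; apply/asboolP; exists y.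
Qed.

Lemma succ_card_lt_wf : well_founded (fun x y => (x < y)%O).
Proof.
move=> x0; apply/notP => nx0.
have [|x nx xmin] := @succ_card_min [set x | ~ Acc (fun x y => (x < y)%O) x].
  by exists x0.
apply: nx; constructor => y yx; apply/notP => /xmin.
by rewrite leNgt yx.
Qed.

Lemma succ_card_ltE x y :
  (y < x)%O <-> set_wo (sval y) (sval x) /\ sval y <> sval x.
Proof.
rewrite lt_neqAle; split=> [/andP[/eqP ne le]|[le ne]]; first split=> //.
  by move=> /val_inj.
by apply/andP; split=> //; apply/eqP => yx; apply: ne; rewrite yx.
Qed.

Lemma card_succ_card_segment x : card_leT {y | (y < x)%O} K.
Proof.
have /asboolP/card_le_set_type := svalP x; apply: card_leT_trans.
apply/card_leTP.
have yP (y : {y | (y < x)%O}) :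
    sval (sval y) \in [set y | set_wo y (sval x) /\ y <> sval x].
  by rewrite inE; apply/succ_card_ltE; apply: svalP y.
exists (fun u => SigSub (yP u)) => u v [] /val_inj.
by case: u v {yP} => [y p] [z q] /= yz; apply: val_inj.
Qed.

Lemma card_succ_card_nle : ~ card_leT (succ_card K) K.
Proof.
move=> le.
case: (pselect (forall s : set K,
    [set y | set_wo y s /\ y <> s] #<= [set: K])) => [all|].
  apply: (@Cantor_card K); apply: card_leT_trans le; apply/card_leTP.
  by exists (fun s => exist _ s (asboolT (all s))) => s t [].
move=> /existsNP[s0 ns0].
(* By minimality the strict predecessors of [s] all lie in [succ_card K], so [le] embeds them in
   [K], against the choice of [s]. *)
have [||s [[/asboolP ns smin] _]] := @set_wo_chain K
    [pred s | `[< ~ ([set y | set_wo y s /\ y <> s] #<= [set: K]) >]].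
- by [].
- by exists s0; apply/asboolP.
apply: ns; apply/card_le_set_type; apply: card_leT_trans le.
have good (y : [set y | set_wo y s /\ y <> s]) :
    `[< [set z | set_wo z (val y) /\ z <> val y] #<= [set: K] >].
  apply/asboolP; apply: contrapT => ny; have [ys nys] := set_mem (valP y).
  have sy : set_wo s (val y) by apply: smin; apply/asboolP.
  by apply: nys; apply: (wo_chain_antisymmetric (@set_wo_chain K)); rewrite ?ys.
apply/card_leTP; exists (fun u => exist _ (val u) (good u)) => u v [].
exact: val_inj.
Qed.

(* Transfinite recursion: the earlier values never exhaust [A], since there are
   at most [K] of them. *)
Lemma card_succ_card_le (A : Type) :
  ~ card_leT A K -> card_leT (succ_card K) A.
Proof.
move=> nAK.
have fresh x (f : forall y, (y < x)%O -> A) :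
    {a | forall y (yx : (y < x)%O), f y yx <> a}.
  apply: cid; apply: contrapT => /forallNP nf; apply: nAK.
  have /choice[g gP] : forall a, exists y : {y | (y < x)%O},
      f (sval y) (proj2_sig y) = a.
    move=> a; have /existsNP[y /existsNP[yx /contrapT fy]] := nf a.
    by exists (exist _ y yx).
  apply: card_leT_trans (card_succ_card_segment x); apply/card_leTP.
  by exists g => a b gab; rewrite -(gP a) -(gP b) gab.
pose F := Fix succ_card_lt_wf (fun=> A) (fun x f => sval (fresh x f)).
have FE x : F x = sval (fresh x (fun y _ => F y)).
  rewrite /F Fix_eq // => y f g fg; congr (sval (fresh y _)).
  apply: functional_extensionality_dep => z.
  exact: functional_extensionality_dep.
have F_lt x y : (y < x)%O -> F y <> F x.
  by move=> yx; rewrite [F x]FE; apply: (svalP (fresh x (fun y _ => F y))).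
apply/card_leTP; exists F => x y Fxy; case: (ltgtP x y) => // /F_lt.
  by rewrite Fxy.
by rewrite Fxy.
Qed.

End SuccCard.

(** * The first uncountable ordinal and its cardinal arithmetic *)

Lemma omega1_uncountable : ~ countable [set: omega1].
Proof. exact: card_succ_card_nle. Qed.

Lemma omega1_infinite : infinite_set [set: omega1].
Proof. by move/finite_set_countable/omega1_uncountable. Qed.

Lemma card_nat_omega1 : card_leT nat omega1.
Proof. exact/infiniteP/omega1_infinite. Qed.

Lemma countable_omega1_segment (x : omega1) : countable [set y | (y < x)%O].
Proof.
apply/card_le_set_type; apply: card_leT_trans (card_succ_card_segment x).
apply/card_leTP.
exists (fun u => exist (fun y => (y < x)%O) (val u) (set_mem (valP u))).
by move=> u v [] /val_inj.
Qed.

(** By [card_succ_card_le], no cardinal lies strictly between those of [nat] and [omega1]. *)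
Lemma countable_omega1_nle (A : set omega1) :
  ~ ([set: omega1] #<= A) -> countable A.
Proof.
move=> nle; apply/card_le_set_type; apply: contrapT => /card_succ_card_le.
by rewrite /card_leT (card_le_eqr (card_setT A)).
Qed.

(** The small sets are countable, and so are countable unions of them. *)
Lemma omega1_regular : regular_cardinal omega1.
Proof.
split; first exact: omega1_infinite.
move=> D F nD nF eqT; apply: omega1_uncountable; rewrite -eqT.
apply: bigcup_countable => [|i Di]; apply: countable_omega1_nle => //.
exact: nF.
Qed.

Lemma omega1_limit : limit_ordinal omega1.
Proof.
split; first exact: succ_card_min.
  by have /card_leTP[f _] := card_nat_omega1; exists (f 0).
(* With a maximum [x], [omega1] would consist of [x] and the countable segment below it. *)
move=> x; apply: contrapT => /forallNP xmax; apply: omega1_uncountable.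
have -> : [set: omega1] =
    \bigcup_(b in [set: bool]) (if b then [set x] else [set y | (y < x)%O]).
  apply/seteqP; split=> // y _; case: (ltgtP y x) => [yx|/xmax|->] //.
    by exists false.
  by exists true.
apply: bigcup_countable => // -[] _; first exact: countable1.
exact: countable_omega1_segment.
Qed.

Lemma bounded_omega1_ideal : is_ideal (bounded_ideal omega1).
Proof.
have /card_leTP[f _] := card_nat_omega1.
split.
- by exists (f 0).
- by move=> A B AB [x Bx]; exists x => y /AB/Bx.
- move=> A B [x Ax] [y By]; exists (Order.max x y) => z [/Ax|/By] zx.
    by rewrite le_max zx.
  by rewrite le_max zx orbT.
- move=> [x xub]; have [_ _ /(_ x)[y]] := omega1_limit.
  by rewrite ltNge => /negP; apply; apply: xub.
Qed.

(** The two sides come from unrelated well-orders; they are compared by minimality of [succ_card K],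
    as the uncountable [omega1] does not embed in [K]. *)
Lemma card_omega1_succ (K : Type) : card_leT K nat ->
  card_leT (succ_card K) omega1.
Proof.
move=> Kc; apply: card_succ_card_le => le; apply: omega1_uncountable.
exact: card_leT_trans le Kc.
Qed.

Lemma card_omega1_square :
  card_leT (omega1 * nat) omega1 -> card_leT (omega1 * omega1) omega1.
Proof.
apply: card_leT_trans.
have /choice[g gI] : forall x : omega1, exists g : omega1 -> nat,
    {in [set y | (y < x)%O] &, injective g}.
  by move=> x; apply/countable_injP/countable_omega1_segment.
apply/card_leTP.
(* The tag 0, 1 or 2 tells how the coordinates compare; [g] numbers the smaller one among the
   ordinals below the maximum. *)
exists (fun ab : omega1 * omega1 => let: (a, b) := ab in
  if (a < b)%O then (b, pickle (1, g b a))
  else if (b < a)%O then (a, pickle (2, g a b)) else (a, pickle (0, 0))).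
move=> [a b] [a' b'].
have pI := pcan_inj (@pickleK (nat * nat)%type).
case: (ltgtP a b) => ab; case: (ltgtP a' b') => ab' E;
  have /= eb := congr1 fst E; have /pI {}E := congr1 snd E;
  have /= := congr1 snd E; have /= := congr1 fst E => // _.
- by rewrite -eb in ab' *; move/gI => ->; rewrite // inE.
- by rewrite -eb in ab' *; move/gI => ->; rewrite // inE.
- by rewrite -ab -ab' eb.
Qed.

Lemma card_seq_omega1 :
  card_leT (omega1 * nat) omega1 -> card_leT (seq omega1) omega1.
Proof.
move=> mul; have /card_leTP[h hI] := card_omega1_square mul.
have /card_leTP[f _] := card_nat_omega1.
(* [f 0] is an arbitrary code for the empty list. Codes of lists of different lengths may collide,
   so the length is kept as well. *)
pose enc := foldr (fun a c => h (a, c)) (f 0).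
apply: card_leT_trans mul; apply/card_leTP.
exists (fun s => (enc s, size s)).
elim=> [|a s IH] [|b t] //= [] /hI [] -> est sz.
by congr cons; apply: IH; rewrite est sz.
Qed.

(* Splitting off a copy of [omega1] from a set too large to embed in it leaves
   a set that is still too large, hence contains the next cardinal. *)
Lemma card_lt_sum_succ_omega1 (K A : Type) : card_leT K nat ->
  card_leT (omega1 * nat) omega1 ->
  card_ltT A (succ_card K + succ_card omega1) <-> card_leT A omega1.
Proof.
move=> Kc mul; split=> [[_ nle]|le]; last first.
  have le2 : card_leT omega1 (succ_card omega1).
    apply: card_succ_card_le => le'; apply: (@card_succ_card_nle omega1).
    exact: card_leT_trans le' card_nat_omega1.
  split.
    apply: card_leT_trans le (card_leT_trans le2 _); apply/card_leTP.
    by exists inr => x y [].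
  move=> /card_leT_trans/(_ le) le3; apply: (@card_succ_card_nle omega1).
  by apply: card_leT_trans le3; apply/card_leTP; exists inr => x y [].
apply: contrapT => nA; apply: nle.
have /card_leTP[f fI] : card_leT (succ_card K) A.
  apply: card_leT_trans (card_omega1_succ Kc) _.
  apply: card_succ_card_le => Anat; apply: nA.
  exact: card_leT_trans Anat card_nat_omega1.
(* Otherwise [A] would embed in [omega1 + omega1], hence in [omega1 * nat] and in [omega1]. *)
have /card_succ_card_le/card_leTP[g gI] : ~ card_leT {a | ~ range f a} omega1.
  move=> /card_leTP[g gI]; apply: nA; apply: card_leT_trans mul.
  have /card_leTP[k kI] := card_omega1_succ Kc.
  apply: card_leT_trans (card_leT_sum_prod (card_leT_refl _)).
  have /choice[r rP] : forall a, exists r : omega1 + omega1,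
      (exists2 x, f x = a & r = inl (k x)) \/
      (exists2 u : {a | ~ range f a}, sval u = a & r = inr (g u)).
    move=> a; case: (pselect (range f a)) => [[x _ fx]|na].
      by exists (inl (k x)); left; exists x.
    by exists (inr (g (exist _ a na))); right; exists (exist _ a na).
  apply/card_leTP; exists r => a b rab.
  case: (rP a) rab => [[x <- ->]|[u <- ->]];
    case: (rP b) => [[y <- ->]|[v <- ->]] // [].
  - by move/kI->.
  - by move/gI->.
apply/card_leTP.
exists (fun x => match x with inl x => f x | inr y => sval (g y) end).
move=> [x|x] [y|y] /=.
- by move/fI->.
- by case: (g y) => b nb /= fx; case: nb; exists x.
- by case: (g x) => b nb /= fx; case: nb; exists y.
- move=> gxy; congr inr; apply: gI; move: gxy.
  case: (g x) (g y) => [b nb] [c nc] /= bc; rewrite bc in nb *.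
  by congr exist; apply: Prop_irrelevance.
Qed.

(** A finitely supported family is recovered from the list of its indexed values on the support. *)
Lemma card_dsum (R : pzRingType) (I : Type) (M : I -> lmodType R) :
  card_leT (dsum M) (seq {i & M i}).
Proof.
elim/Peq: I => I in M *.
have /choice[s sP] : forall f : dsum M, exists s : seq I,
    [set i | sval f i != 0%R] = [set` s].
  by move=> f; apply/finite_seqP/dsum_finite.
apply/card_leTP.
exists (fun f => [seq existT _ i (sval f i) | i <- s f]) => f g.
move=> efg; apply: dsum_ext.
have sub (u v : dsum M) :
    [seq existT M i (sval u i) | i <- s u] =
    [seq existT M i (sval v i) | i <- s v] ->
    forall i, sval u i != 0%R -> sval u i = sval v i.
  move=> e i ui; have /seteqP[/(_ i ui) /= si _] := sP u.
  have /mapP[j _ ej] : existT M i (sval u i)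
      \in [seq existT M i (sval v i) | i <- s v] by rewrite -e map_f.
  (* Phrased with [tag] and [tagged] so that rewriting by [ej] changes index and value together. *)
  suff : tagged (existT M i (sval u i)) =
    sval v (tag (existT M i (sval u i))) by [].
  by rewrite ej.
move=> i; have [fi0|/(sub _ _ efg)//] := eqVneq (sval f i) 0%R.
by have [gi0|/(sub _ _ (esym efg))//] := eqVneq (sval g i) 0%R; rewrite fi0 gi0.
Qed.

Lemma card_dsum_omega1 (R : pzRingType) (I : Type) (M : I -> lmodType R) :
  card_leT (omega1 * nat) omega1 -> card_leT {i & M i} omega1 ->
  card_leT (dsum M) omega1.
Proof.
move=> mul /card_leTP[f fI]; apply: card_leT_trans (@card_dsum R I M) _.
apply: card_leT_trans (card_seq_omega1 mul).
by apply/card_leTP; exists (map f); apply: inj_map.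
Qed.

End Cardinals.

(** * Linear maps and direct sums *)

Section LinearMaps.
Local Open Scope ring_scope.
Local Open Scope classical_set_scope.
Variable R : pzRingType.
Implicit Types L M N : lmodType R.

Lemma linear_exists L M (f : L -> M) :
  linear f -> exists g : {linear L -> M}, g =1 f.
Proof.
move=> fL; pose m := GRing.isLinear.Build R L M *:%R f fL.
by exists (HB.pack_for {linear L -> M} f m).
Qed.

Lemma mod_iso_can L M : mod_iso L M ->
  exists (f : {linear L -> M}) (g : {linear M -> L}), cancel f g /\ cancel g f.
Proof.
move=> [f [g fK gK]]; have [g' g'E] := linear_exists (can2_linear fK gK).
by exists f, g'; split=> x; rewrite g'E.
Qed.

Lemma mod_iso_sym L M : mod_iso L M -> mod_iso M L.
Proof. by move=> /mod_iso_can[f [g [fK gK]]]; exists g, f. Qed.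

Lemma mod_iso_trans M L N : mod_iso L M -> mod_iso M N -> mod_iso L N.
Proof. by move=> [f fB] [g gB]; exists (g \o f); apply: bij_comp. Qed.

Lemma mod_iso_card L M : mod_iso L M -> card_leT L M.
Proof. by move=> [f /bij_inj fI]; apply/card_leTP; exists f. Qed.

(** These are the projection to coordinate [i] and the inclusion that is zero elsewhere. *)
Lemma dsum_coord_split (I : eqType) (M : I -> lmodType R) (i : I) :
  exists (rho : {linear dsum M -> M i}) (sigma : {linear M i -> dsum M}),
    cancel sigma rho.
Proof.
have dfw_finite (x : M i) :
    finite_set [set j | dfwith (fun j => 0 : M j) x j != 0].
  apply: (@sub_finite_set _ _ [set i]) => [j /=|]; last exact: finite_set1.
  by have [<-//|ij] := eqVneq i j; rewrite dfwith_out ?eqxx.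
have [rho rhoE] : exists rho : {linear dsum M -> M i},
    forall f, rho f = sval f i.
  exact: linear_exists.
have [sigma sigmaE] : exists sigma : {linear M i -> dsum M},
    forall x, sigma x =
      exist _ (dfwith (fun j => 0) x) (asboolT (dfw_finite x)).
  apply: linear_exists => c x y; apply: dsum_ext => j /=.
  have [<-|ij] := eqVneq i j; first by rewrite !dfwith_in.
  by rewrite !dfwith_out ?scaler0 ?addr0.
by exists rho, sigma => x; rewrite rhoE sigmaE /= dfwith_in.
Qed.

Lemma dsum_reindex (I J : Type) (M : I -> lmodType R) (N : J -> lmodType R)
    (psi : J -> I) :
  bijective psi -> (forall j, mod_iso (M (psi j)) (N j)) ->
  mod_iso (dsum M) (dsum N).
Proof.
move=> psiB isoMN; have psiI := bij_inj psiB; case: psiB => phi psiK phiK.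
have /all_sig[a aB] := fun j => cid (isoMN j).
have aF (f : dsum M) : finite_set [set j | a j (sval f (psi j)) != 0].
  apply: (@sub_finite_set _ _ (phi @` [set i | sval f i != 0])).
    move=> j /= aj; exists (psi j) => //.
    by apply: contra_neq aj => ->; rewrite linear0.
  exact/finite_image/dsum_finite.
have [A AE] : exists A : {linear dsum M -> dsum N},
    forall f, A f = exist _ (fun j => a j (sval f (psi j))) (asboolT (aF f)).
  by apply: linear_exists => c x y; apply: dsum_ext => j /=; rewrite linearP.
exists A; rewrite -setTT_bijective; split=> // [f f' _ _|g _].
  rewrite !AE => /(congr1 sval) eA; apply: dsum_ext => i.
  rewrite -(phiK i); apply: (bij_inj (aB (phi i))).
  exact: (congr1 (fun u => u (phi i)) eA).
(* An index [i] equals [psi (phi i)] only propositionally, so the coordinate at [i] of the preimage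
   is specified through casts along proofs of [psi j = i]. *)
have /all_sig[x xP] : forall i, {x : M i |
    forall j (e : psi j = i), a j (ecast i (M i) (esym e) x) = sval g j}.
  move=> i; apply: cid; rewrite -(phiK i); have [b _ bK] := aB (phi i).
  exists (b (sval g (phi i))) => j e; have ej := psiI _ _ e; subst j.
  by rewrite (Prop_irrelevance e erefl) /= bK.
have xE j : a j (x (psi j)) = sval g j := xP (psi j) j erefl.
have xF : finite_set [set i | x i != 0].
  apply: (@sub_finite_set _ _ (psi @` [set j | sval g j != 0])).
    move=> i; rewrite /= -(phiK i) => xi; exists (phi i) => //; rewrite -xE.
    apply: contra_neq xi => a0; apply: (bij_inj (aB (phi i))).
    by rewrite linear0.
  exact/finite_image/dsum_finite.
exists (exist _ x (asboolT xF)) => //; rewrite AE.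
by apply: dsum_ext => j /=; rewrite xE.
Qed.

(* [h] splits off [G] from [G0], and [rho] a summand [Z0] killed by [c] from
   [G].  Embedding that summand into [Z1], where its element [w] is divisible by
   [c], leaves no room for an extension of [h]: its value on [w] would be
   nonzero and divisible by [c] in [Z0]. *)
Lemma split_hom_not_extending (G0 G Z0 Z1 : lmodType R)
    (j : {linear G -> G0}) (h : {linear G0 -> G})
    (rho : {linear G -> Z0}) (sigma : {linear Z0 -> G})
    (iota : {linear Z0 -> Z1}) (c : R) (w : Z0) (z : Z1) :
  cancel j h -> cancel sigma rho -> injective iota ->
  (forall x : Z0, c *: x = 0) -> w != 0 -> iota w = c *: z ->
  exists emb : {linear G0 -> (G0 * Z1)%type}, injective emb /\
    ~ exists g : {linear (G0 * Z1)%type -> G}, forall x, g (emb x) = h x.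
Proof.
move=> jK sK iI c0 w0 wz.
(* The map [j \o sigma \o rho \o h] projects [G0] onto the copy of [Z0]. [emb] moves that component
   into [Z1]; the second coordinate determines it, and the first then determines [x]. *)
have [emb embE] : exists emb : {linear G0 -> (G0 * Z1)%type},
    forall x, emb x = (x - j (sigma (rho (h x))), iota (rho (h x))).
  apply: linear_exists => a x y.
  rewrite !linearP; congr pair => /=.
  by rewrite scalerDr addrACA.
exists emb; split=> [x y|[g gE]].
  by rewrite !embE => -[+ /iI exy]; rewrite exy => /addIr.
have := gE (j (sigma w)); rewrite embE jK sK subrr wz.
have -> : (0, c *: z) = c *: (0, z) :> (G0 * Z1)%type.
  by congr pair; rewrite scaler0.
move=> /(congr1 rho); rewrite !linearZ_LR c0 sK => /esym/eqP.
by rewrite (negPf w0).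
Qed.

End LinearMaps.

(** * The cyclic groups Z/p and Z/p^2 *)

Section PrimePowers.
Local Open Scope ring_scope.

(** Integer scalars act by repeated addition and negation. *)
Lemma int_linear (M N : lmodType int) (f : M -> N) :
  {morph f : x y / x + y} -> linear f.
Proof.
move=> fD; have f0 : f 0 = 0 by apply: (addrI (f 0)); rewrite -fD !addr0.
have fB : zmod_morphism f.
  by move=> x y; apply: (addIr (f y)); rewrite -fD !subrK.
pose F : {additive M -> N} :=
  HB.pack_for {additive M -> N} f (GRing.isZmodMorphism.Build M N f fB).
move=> a x y; rewrite fD; congr (_ + _).
by rewrite -[a]intz !scaler_int; apply: (raddfMz F).
Qed.

Variable p : nat.
Hypothesis p_gt1 : (1 < p)%N.

Lemma Zpow_card_nat n : card_leT (Zpow p n) nat.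
Proof.
apply/card_leTP; exists (@nat_of_ord _ : 'Z_(p ^ n.+1) -> nat).
exact: val_inj.
Qed.

Lemma Zpow0_scale (x : Zpow p 0) : (p%:Z : int) *: x = 0.
Proof.
rewrite -natz scaler_nat; change ((x : 'Z_(p ^ 1)) *+ p = 0).
by rewrite -mulr_natr (@pchar_Zp (p ^ 1)) ?mulr0.
Qed.

(** Multiplication by [p] from Z/p to Z/p^2 (exponents in [Zpow] are shifted by one). *)
Lemma Zpow_mul_embedding :
  exists iota : {linear Zpow p 0 -> Zpow p 1},
    injective iota /\ exists z, iota (1 : 'Z_(p ^ 1)) = (p%:Z : int) *: z.
Proof.
have p2_gt1 : (1 < p ^ 2)%N by rewrite (ltn_exp2l 0).
pose iota (x : 'Z_(p ^ 1)) : 'Z_(p ^ 2) := (x * p)%:R.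
(* Since [x < p], the product is below [p ^ 2] and is not reduced; injectivity follows. *)
have valiota x : iota x = (x * p)%N :> nat.
  rewrite val_Zp_nat // modn_small // -[(p ^ 2)%N]/(p * p)%N.
  rewrite ltn_pmul2r ?(ltnW p_gt1) //.
  by move: (ltn_ord x); rewrite [X in (_ < X)%N]Zp_cast.
have iotaD : {morph iota : x y / x + y}.
  move=> x y; rewrite /iota -natrD -mulnDl; apply: val_inj.
  have -> : nat_of_ord (x + y) = ((x + y) %% p)%N.
    by congr (_ %% _)%N; apply: Zp_cast.
  by rewrite /= !val_Zp_nat // muln_modl modn_mod.
have [f fE] : exists f : {linear Zpow p 0 -> Zpow p 1}, f =1 iota.
  by apply/linear_exists/int_linear/iotaD.
exists f; split=> [x y|].
  rewrite !fE => /(congr1 (@nat_of_ord _)); rewrite !valiota => /eqP.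
  by rewrite eqn_pmul2r ?(ltnW p_gt1) // => /eqP/val_inj.
exists (1 : 'Z_(p ^ 2)); rewrite fE -natz scaler_nat.
by rewrite /iota mul1n.
Qed.

End PrimePowers.

(** * The module problem of Xi^1_p and its fitting *)

Section Xi1.
Local Open Scope ring_scope.
Variables (p k : nat).
Hypotheses (p_gt1 : (1 < p)%N) (k_gt0 : (0 < k)%N).

(** The group of Xi^1_p, with the ordinal omega * a + n replaced by the pair [(a, n)]. *)
Definition Xi1_module : lmodType int :=
  dsum (fun q : 'I_k * (omega1 * nat) => Zpow p q.2.2).

(** The isomorphism [e] in the triple serves twice: as an injection and to reindex the direct
    sum. *)
Lemma Xi1P t : Xi1 p k t ->
  card_leT (omega1 * nat) omega1 /\
  exists2 G : lmodType int, mod_iso G Xi1_module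
    & t = HomTriple (idfun : {linear G -> G}).
Proof.
move=> [F [G [e [[[e' eK e'K] _] Fe GF ->]]]]; split.
  by apply/card_leTP; exists e; apply: can_inj eK.
exists G => //; apply: mod_iso_trans GF _.
pose psi (q : 'I_k * (omega1 * nat)) := (q.1, e q.2).
apply: (@dsum_reindex _ _ _ _ _ psi).
  by exists (fun q => (q.1, e' q.2)) => -[m x] /=; rewrite /psi ?eK ?e'K.
by move=> [m [a n]]; apply: Fe.
Qed.

Lemma card_Xi1_module :
  card_leT (omega1 * nat) omega1 -> card_leT Xi1_module omega1.
Proof.
move=> mul; apply: card_dsum_omega1 => //.
apply: (@card_leT_trans ((omega1 * nat) * nat)%type); last first.
  apply: (card_leT_trans _ mul); apply: card_leT_prod => //.
  exact: card_leT_refl.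
(* The index [m] and the residue [z] are packed into one natural number. *)
apply/card_leTP; exists (fun x : {q : 'I_k * (omega1 * nat) & Zpow p q.2.2} =>
  let: existT (m, (a, n)) z := x in
  ((a, n), pickle (nat_of_ord m, nat_of_ord (z : 'Z_(p ^ n.+1))))).
move=> [[m [a n]] x] [[m' [a' n']] x'] E.
have /= [ea en] := congr1 fst E.
have /(pcan_inj (@pickleK _)) /= [/val_inj em] := congr1 snd E.
by move: x' {E}; rewrite -ea -en -em => x' /val_inj ->.
Qed.

Lemma Xi1_module_split :
  exists (rho : {linear Xi1_module -> Zpow p 0})
         (sigma : {linear Zpow p 0 -> Xi1_module}), cancel sigma rho.
Proof.
have /card_leTP[f _] := card_nat_omega1.
(* The last 0 selects a summand Z/p; [f 0] is an arbitrary point of [omega1]. *)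
exact: (@dsum_coord_split _ _ _ (Ordinal k_gt0, (f 0%N, 0%N))).
Qed.

Lemma Xi1_module_problem : @module_problem omega1 (d1 p) (Xi1 p k).
Proof.
have [rho [sigma sK]] := Xi1_module_split.
have /card_leTP[f fI] := card_nat_omega1.
split; first exact: omega1_infinite.
split; first exact: omega1_regular.
split.
  move=> t /Xi1P[_ [G [g [g' gK g'K]] ->]] /=.
  exists (g' (sigma (1 : 'Z_(p ^ 1)))) => /(congr1 (rho \o g)) /=.
  by rewrite g'K sK !linear0 => /eqP; rewrite oner_eq0.
split.
  (* All triples are isomorphic, so a constant map will do. *)
  exists (fun=> f 0%N) => s t /Xi1P[_ [G GS ->]] /Xi1P[_ [G' G'S ->]] _.
  have [h hB] := mod_iso_trans GS (mod_iso_sym G'S).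
  by exists h, h.
split.
  move=> t /Xi1P[mul [G GS ->]] /=.
  have GO := card_leT_trans (mod_iso_card GS) (card_Xi1_module mul).
  apply: (card_leT_trans _ mul).
  apply: card_leT_trans (card_leT_sum_prod (card_leT_refl _)) _.
  by apply: card_leT_prod => //; apply: card_leT_refl.
split.
  (* A member of the class is coded by its exponent; other modules get an arbitrary value. *)
  have /choice[c cP] : forall M : lmodType int,
      exists n, (exists n, M = Zpow p n) -> M = Zpow p n.
    move=> M; case: (pselect (exists n, M = Zpow p n)) => [[n ->]|nM].
      by exists n.
    by exists 0%N.
  exists (f \o c) => M N /cP eM /cP eN /fI cMN.
  by rewrite eM eN cMN.
split.
  move=> _ [n ->]; exact: card_leT_trans (Zpow_card_nat p n) card_nat_omega1.
apply: card_leT_trans card_nat_omega1; exact: countableP.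
Qed.

Lemma Xi1_theta_fits :
  @theta_fits succ_card_display k (fun=> omega1) (fun=> bounded_ideal omega1)
    omega1 (d1 p) (Xi1 p k) (succ_card int + succ_card omega1)%type.
Proof.
split; first by move=> _; exact: omega1_limit.
split; first by move=> _; exact: bounded_omega1_ideal.
split; first exact: Xi1_module_problem.
move=> t Mstar N h0 M /Xi1P[mul [G GS et]].
rewrite et in h0 *; move=> _ _ _ _ lt G0 h1 h1K.
(* Here theta amounts to aleph_2: being below it means having at most aleph_1 elements. *)
have lt_omega1 A := @card_lt_sum_succ_omega1 int A (countableP _) mul.
have [g [g' [gK g'K]]] := mod_iso_can GS.
have [rho [sigma sK]] := Xi1_module_split.
have [iota [iotaI [z iotaz]]] := Zpow_mul_embedding p_gt1.
(* As h_* is the identity, [h1K] makes [h1] a left inverse of this [j]. *)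
have [j jE] : exists j : {linear G -> G0}, forall x, j x = (0, h0 x).
  apply: linear_exists => a x y; rewrite linearP; congr pair.
  by rewrite /= scaler0 addr0.
have [||||||emb [embI nemb]] :=
    @split_hom_not_extending _ G0 G (Zpow p 0) (Zpow p 1) j h1
      (rho \o g) (g' \o sigma) iota p%:Z (1 : 'Z_(p ^ 1)) z.
- by move=> x; rewrite jE h1K.
- by move=> x; rewrite /= g'K sK.
- exact: iotaI.
- exact: Zpow0_scale.
- exact: oner_neq0.
- exact: iotaz.
exists (G0 * Zpow p 1)%type, emb; split => // /lt_omega1 leM.
apply/lt_omega1; have sq := card_omega1_square mul.
apply: (card_leT_trans _ sq); apply: card_leT_prod; last first.
  exact: card_leT_trans (Zpow_card_nat p 1) card_nat_omega1.
apply: (card_leT_trans _ sq); apply: card_leT_prod => //.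
apply: card_dsum_omega1 => //.
(* Only the bracketing of the index pair differs between this sum and the one bounded by [lt]. *)
move/lt_omega1: lt; apply: card_leT_trans; apply/card_leTP.
exists (fun x => existT _ (tag (tag x))
  (existT (fun i => M (tag (tag x)) i) (tagged (tag x)) (tagged x))).
apply: (can_inj (g := fun y =>
  existT (fun mi : {m : 'I_k & omega1} => M (tag mi) (tagged mi))
    (existT (fun=> (omega1 : Type)) (tag y) (tag (tagged y)))
    (tagged (tagged y)))).
by move=> [[m i] x].
Qed.

End Xi1.

Theorem theorem1p6 (p k : nat) (p_prime : prime p) (k_gt0 : 0 < k) :
  @fits succ_card_display k (fun=> omega1) (fun=> bounded_ideal omega1)
    omega1 (d1 p) (Xi1 p k).
Proof.
(* All the ordinals are [omega1], so any index attains the maximum. *)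
exists (Ordinal k_gt0); split; first by move=> m; apply: card_leT_refl.
exact: Xi1_theta_fits (prime_gt1 p_prime) k_gt0.
Qed.
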